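(* Let $1\le m\le n-1$ be integers. For any real number $s$ with $0<s\le m$ there is a positive number $p_0=p_0(n,m,s)$ such that for any prime number $p\ge p_0$ there exists a subset $E\subset\mathbb{F}_p^n$ with $p^{s}/2\le |E|\le 2p^{s}$ such that $$|\pi^{W}(E)|\ge |E|/24\quad\text{for all } W\in G(n,n-m).$$
   Context: $\mathbb{F}_p$ is the field with $p$ elements ($p$ prime). $|J|$ denotes the cardinality of a finite set $J$. $G(n,k)$ denotes the set of all $k$-dimensional linear subspaces of $\mathbb{F}_p^n$. For a subspace $W$ of $\mathbb{F}_p^n$ and $E\subset\mathbb{F}_p^n$, $\pi^W(E)$ is the set of cosets of $W$ that meet $E$: $$\pi^{W}(E)=\{x+W: x\in\mathbb{F}_p^n,\ E\cap(x+W)\ne\emptyset\}.$$ *)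

(* Defs.v *)
From mathcomp Require Import all_boot all_order all_algebra.

Set Implicit Arguments.
Unset Strict Implicit.
Unset Printing Implicit Defensive.

Import GRing.Theory.
Local Open Scope ring_scope.

(* 'F_p is the field with p elements only when p is prime; every use below is
   under that hypothesis. *)
Definition vcoset (p n : nat) (W : {vspace 'rV['F_p]_n}) (x : 'rV['F_p]_n) :
  {set 'rV['F_p]_n} := [set x + w | w in W].

Definition cosets_meeting (p n : nat) (W : {vspace 'rV['F_p]_n})
    (E : {set 'rV['F_p]_n}) : {set {set 'rV['F_p]_n}} :=
  [set vcoset W x | x : 'rV['F_p]_n & E :&: vcoset W x != set0].

(* Main.v *)
(** The set E is the image of a random map f from 4k points to F_p^n, where
    k = floor (p^s / 2). For a fixed W of dimension n - m, the cosets of the f i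
    are uniform among the M = p^m cosets of W, so at most k of them are distinct
    with probability at most C(M, k) (k / M)^(4k), which is at most 2^-k because
    2k <= M and k^k <= 4^k k!. There are at most p^(n^2) choices of W, and
    p^(n^2) < 2^k once p is large, so some f hits more than k cosets of every W.
    Then |E| > k as well, while |E| <= 4k. *)
Require Import Defs.
From mathcomp Require Import all_boot all_order all_algebra finfield.
From mathcomp Require Import reals exp.
From mathcomp Require Import zify lra.

Set Implicit Arguments.
Unset Strict Implicit.
Unset Printing Implicit Defensive.

Import Order.TTheory GRing.Theory Num.Theory.

Lemma bin_le_exp2 n k : 'C(n, k) <= 2 ^ n.
Proof.
have [le_kn|lt_nk] := leqP k n; last by rewrite bin_small.
rewrite -[2]/(1 + 1) expnDn (bigD1 (Ordinal (le_kn : k < n.+1))) //=.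
by rewrite !exp1n !muln1 leq_addr.
Qed.

(* A weak form of Stirling's bound, from [(2k)!/k! = 'C(2k, k) k!]. *)
Lemma expn_self_le k : k ^ k <= 4 ^ k * k`!.
Proof.
have le_ffact : k ^ k <= (2 * k) ^_ k.
  rewrite ffact_prod -{2}[k]card_ord -prod_nat_const.
  by apply: leq_prod => i _; have := ltn_ord i; lia.
apply: leq_trans le_ffact _.
by rewrite -bin_ffact -[4]/(2 ^ 2) -expnM leq_mul2r bin_le_exp2 orbT.
Qed.

(** One factor [k ^ k] is absorbed by ['C(M, k)] at the cost of [4 ^ k], by [expn_self_le] and
    ['C(M, k) * k! <= M ^ k]. The other three gain [8 ^ k] from [2 * k <= M], and [8 = 2 * 4] leaves
    the saving [2 ^ k]. *)
Lemma bin_mul_exp_le M k : 2 * k <= M ->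
  2 ^ k * ('C(M, k) * k ^ (4 * k)) <= M ^ (4 * k).
Proof.
case: (posnP k) => [->|k_gt0 le_kM]; first by rewrite muln0 !expn0 bin0.
have le_bin : 'C(M, k) * k ^ k <= 4 ^ k * M ^ k.
  apply: leq_trans (leq_mul (leqnn _) (expn_self_le k)) _.
  have -> : M ^ k = \prod_(i < k) M by rewrite prod_nat_const card_ord.
  rewrite mulnCA leq_mul2l bin_ffact ffact_prod.
  by apply/orP; right; apply: leq_prod => i _; apply: leq_subr.
have le_pow : 8 ^ k * k ^ (3 * k) <= M ^ (3 * k).
  by rewrite -[8]/(2 ^ 3) -expnM -expnMn leq_exp2r ?muln_gt0.
have -> : 4 * k = k + 3 * k by lia.
rewrite (expnD k k) (expnD M k) (mulnA 'C(M, k)).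
apply: leq_trans (leq_mul (leqnn _) (leq_mul le_bin (leqnn _))) _.
apply: leq_trans _ (leq_mul (leqnn (M ^ k)) le_pow).
by rewrite -[8]/(2 * 4) (expnMn 2 4); apply/eq_leq; lia.
Qed.

Lemma exp2_dominates_power D :
  exists K, forall k, K <= k -> (2 * k.+1) ^ D <= 2 ^ k.
Proof.
(* With [a = k %/ D], it is enough that the linear bound [2 D (a + 1)] on
   [2 (k + 1)] be at most [2 ^ a]. *)
case: (posnP D) => [->|D_gt0]; first by exists 0 => k _; rewrite expn0 expn_gt0.
have sqr_le a : a.+1 ^ 2 <= 4 * 2 ^ a.
  elim: a => [//|a IHa]; have [le_a1|a_gt1] := leqP a 1.
    by case: a le_a1 {IHa} => [|[]].
  by move: IHa; rewrite (expnS 2 a) -!mulnn; nia.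
(* This threshold forces [8 * D <= a], so that [2 * D * (a + 1) <= (a + 1) ^ 2 / 4 <= 2 ^ a]. *)
exists (8 * D * D) => k le_Kk; set a := k %/ D.
have le_a : 8 * D <= a by rewrite leq_divRL.
have lt_ka : k < D * a.+1 by rewrite mulnC ltn_ceil.
have base_le : 2 * k.+1 <= 2 ^ a by have := sqr_le a; rewrite -mulnn; nia.
apply: (@leq_trans ((2 ^ a) ^ D)); first by rewrite leq_exp2r.
by rewrite -expnM leq_exp2l // leq_divM.
Qed.

Lemma card_bigcup_leq (I T : finType) (P : pred I) (F : I -> {set T}) :
  #|\bigcup_(i | P i) F i| <= \sum_(i | P i) #|F i|.
Proof.
elim/big_ind2: _ => [|A a B b le_A le_B|//]; first by rewrite cards0.
by apply: leq_trans _ (leq_add le_A le_B); rewrite leq_card_setU.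
Qed.

Section SmallImages.
Variables (T U : finType) (g : T -> U) (d : nat).
Hypothesis fiber_card : forall x, #|[set y | g y == g x]| = d.

(** [S] is kept inside the image because [g] will be [vcoset W], whose codomain contains every set
    of vectors, not only cosets. *)
Lemma card_preim_sub_codom (S : {set U}) :
  S \subset g @: setT -> #|g @^-1: S| = #|S| * d.
Proof.
move=> sS; rewrite -sum1_card (partition_big g (mem S)) /=; last first.
  by move=> x; rewrite inE.
rewrite -sum_nat_const; apply: eq_bigr => u Su.
have /imsetP[x _ ux] := subsetP sS u Su.
rewrite sum1_card -(fiber_card x); apply: eq_card => y.
by rewrite inE -ux -topredE /= inE andb_idl // => /eqP ->.
Qed.

Lemma card_domain_fibers : #|T| = #|g @: setT| * d.
Proof.
rewrite -card_preim_sub_codom // -cardsT; apply: eq_card => x.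
by rewrite !inE imset_f.
Qed.

(** An image of at most [k] values can be padded to a set [S] of exactly [k] values in [g @: setT].
    Then [f] takes its values in the preimage of [S], which has [k * d] points; summing over [S]
    gives the bound. *)
Lemma card_small_image_ffuns N k : k <= #|g @: setT| ->
  #|[set f : {ffun 'I_N -> T} | #|[set g (f i) | i : 'I_N]| <= k]|
    <= 'C(#|g @: setT|, k) * (k * d) ^ N.
Proof.
set Q := g @: setT => le_kQ.
set draws := [set S : {set U} | S \subset Q & #|S| == k].
pose F (S : {set U}) :=
  [set f : {ffun 'I_N -> T} | f \in ffun_on (mem (g @^-1: S))].
apply: (@leq_trans #|\bigcup_(S in draws) F S|).
  apply/subset_leq_card/subsetP => f; rewrite inE => small.
  have sub_Q : [set g (f i) | i : 'I_N] \subset Q.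
    by apply/subsetP => _ /imsetP[i _ ->]; apply: imset_f.
  have [S [sIS sSQ cS]] : exists S : {set U},
      [/\ [set g (f i) | i : 'I_N] \subset S, S \subset Q & #|S| = k].
    set I := [set g (f i) | i : 'I_N] in small sub_Q *.
    have : k - #|I| <= #|Q :\: I| by rewrite cardsDS // leq_sub2r.
    case/card_geqP => s [us ss ssub].
    exists (I :|: [set x in s]).
    have sD : [set x in s] \subset Q :\: I.
      by apply/subsetP => x; rewrite inE; apply: ssub.
    split; first exact: subsetUl.
      by rewrite subUset sub_Q (subset_trans sD) // subsetDl.
    have -> : #|I :|: [set x in s]| = #|I| + #|[set x in s]|.
      apply/eqP; rewrite (leq_card_setU I _).2 disjoint_sym.
      by rewrite disjoints_subset (subset_trans sD) // setDE subsetIr.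
    by rewrite cardsE (card_uniqP us) ss subnKC.
  apply/bigcupP; exists S; first by rewrite inE sSQ cS eqxx.
  rewrite inE; apply/ffun_onP => i; rewrite !inE.
  by apply: (subsetP sIS); apply: imset_f.
apply: leq_trans (card_bigcup_leq _ _) _.
rewrite -(cards_draws Q k) -sum_nat_const; apply: leq_sum => S.
rewrite inE => /andP[sSQ /eqP <-].
by rewrite /F cardsE card_ffun_on card_ord card_preim_sub_codom.
Qed.

End SmallImages.

Local Open Scope ring_scope.

Section LinearProjections.
Variables (p n m : nat).
Hypotheses (p_pr : prime p) (le_mn : (m <= n)%N).
Local Notation V := 'rV['F_p]_n.

Lemma vcoset_eqE (W : {vspace V}) (x y : V) :
  (vcoset W y == vcoset W x) = (y - x \in W).
Proof.
have in_vcoset (z t : V) : (t \in vcoset W z) = (t - z \in W).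
  apply/imsetP/idP => [[w wW ->]|tzW]; first by rewrite addrC addKr.
  by exists (t - z); rewrite // addrC subrK.
apply/eqP/idP => [eq_yx|yxW].
  by rewrite -in_vcoset -eq_yx in_vcoset subrr mem0v.
apply/setP => t; rewrite !in_vcoset; apply/idP/idP => h.
  by rewrite -(subrK y t) -addrA memvD.
by rewrite -[t](subrK x) -addrA -[x - y]opprB memvB.
Qed.

Lemma card_vcoset_fiber (W : {vspace V}) (x : V) : \dim W = (n - m)%N ->
  #|[set y | vcoset W y == vcoset W x]| = (p ^ (n - m))%N.
Proof.
move=> dimW; transitivity #|[set x + w | w in W]|.
  apply: eq_card => y; rewrite inE vcoset_eqE.
  apply/idP/imsetP => [yxW|[w wW ->]]; last by rewrite addrC addKr.
  by exists (y - x); rewrite // addrC subrK.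
by rewrite (card_imset _ (addrI x)) card_vspace dimW card_Fp.
Qed.

Lemma card_vcosets (W : {vspace V}) : \dim W = (n - m)%N ->
  #|vcoset W @: setT| = (p ^ m)%N.
Proof.
move=> dimW; apply/eqP.
rewrite -(eqn_pmul2r (_ : 0 < p ^ (n - m))%N) ?expn_gt0 ?prime_gt0 //.
rewrite -(card_domain_fibers (fun x => card_vcoset_fiber x dimW)).
by rewrite card_mx card_Fp // mul1n -expnD subnKC.
Qed.

Lemma exists_large_projections k :
    (2 * k <= p ^ m)%N -> (p ^ (n * n) < 2 ^ k)%N ->
  exists f : {ffun 'I_(4 * k) -> V}, forall W : {vspace V},
    \dim W = (n - m)%N -> (k < #|[set vcoset W (f i) | i : 'I_(4 * k)]|)%N.
Proof.
move=> le_kpm lt_pn.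
pose bad (W : {vspace V}) :=
  [set f : {ffun 'I_(4 * k) -> V} |
     #|[set vcoset W (f i) | i : 'I_(4 * k)]| <= k]%N.
(* Subspaces are indexed by spanning tuples, with repetition. This is harmless in a union bound, and
   there are only [p ^ (n * (n - m))] tuples. *)
pose B := \bigcup_(X : (n - m).-tuple V | \dim <<X>> == (n - m)%N) bad <<X>>%VS.
have card_bad (W : {vspace V}) : \dim W = (n - m)%N ->
    (2 ^ k * #|bad W| <= (p ^ n) ^ (4 * k))%N.
  move=> dimW; have cQ := card_vcosets dimW.
  have := @card_small_image_ffuns _ _ (vcoset W) (p ^ (n - m))%N
    (fun x => card_vcoset_fiber x dimW) (4 * k) k.
  rewrite cQ => /(_ ltac:(lia)) le_bad.
  apply: leq_trans (leq_mul (leqnn _) le_bad) _.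
  (* Splitting [p ^ n] as [p ^ m * p ^ (n - m)] isolates the coset size on both sides; what remains
     is [bin_mul_exp_le] with [M = p ^ m]. *)
  rewrite -[n in leqRHS](subnKC le_mn) expnD !expnMn 2!mulnA -(mulnA (2 ^ k)%N).
  by apply: leq_mul => //; apply: bin_mul_exp_le.
have card_B : (#|B| < #|{ffun 'I_(4 * k) -> V}|)%N.
  rewrite card_ffun card_mx card_Fp // card_ord mul1n.
  rewrite -(ltn_pmul2l (_ : 0 < 2 ^ k)%N) ?expn_gt0 //.
  apply: (@leq_ltn_trans (p ^ (n * n) * (p ^ n) ^ (4 * k))); last first.
    by rewrite ltn_pmul2r // !expn_gt0 prime_gt0.
  apply: leq_trans (leq_mul (leqnn _) (card_bigcup_leq _ _)) _.
  rewrite big_distrr /=.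
  apply: (@leq_trans (\sum_(X : (n - m).-tuple V) (p ^ n) ^ (4 * k))%N).
    rewrite [leqRHS](bigID (fun X : (n - m).-tuple V =>
      \dim <<X>> == (n - m)%N)) /=.
    apply: leq_trans _ (leq_addr _ _).
    by apply: leq_sum => X /eqP dimX; apply: card_bad.
  rewrite sum_nat_const card_tuple card_mx card_Fp // mul1n.
  apply: leq_mul => //; rewrite -expnM leq_exp2l ?prime_gt1 //.
  by rewrite leq_mul2l leq_subr orbT.
have [f fB] : exists f, f \notin B.
  apply/existsP; rewrite -negb_forall; apply/negP => /forallP allB.
  by move: card_B; rewrite ltnNge subset_leq_card //; apply/subsetP => f _.
exists f => W dimW; rewrite ltnNge; apply: contra fB => small.
apply/bigcupP; exists (tcast dimW (vbasis W)).
  by rewrite val_tcast (span_basis (vbasisP W)) dimW.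
by rewrite val_tcast (span_basis (vbasisP W)) inE.
Qed.

End LinearProjections.

Theorem theorem1p5 (R : realType) (n m : nat) (hm : (1 <= m <= n - 1)%N)
    (s : R) (hs0 : 0 < s) (hsm : s <= m%:R) :
  exists p0 : R, 0 < p0 /\
    forall p : nat, prime p -> p0 <= p%:R ->
      exists E : {set 'rV['F_p]_n},
        [/\ p%:R `^ s / 2 <= #|E|%:R,
            #|E|%:R <= 2 * p%:R `^ s
          & forall W : {vspace 'rV['F_p]_n}, \dim W = (n - m)%N ->
              #|E|%:R / 24 <= #|cosets_meeting W E|%:R :> R].
Proof.
have le_mn : (m <= n)%N by lia.
(* [D] exceeds [n ^ 2 / s], so [p ^ (n * n)] is at most the [D]-th power of [p ^ s]. *)
pose D := (Num.truncn ((n * n)%:R / s)).+1.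
have [K K_dom] := exp2_dominates_power D.
(* Chosen so that [p ^ s >= 2 * (K + 1)], which puts [k] in the range of [K_dom]. *)
exists ((2 * K.+1%:R) `^ s^-1); split.
  by apply: powR_gt0; rewrite mulr_gt0.
move=> p p_pr le_p0p; set y : R := p%:R `^ s.
have p_ge1 : 1 <= p%:R :> R by rewrite ler1n prime_gt0.
have y_ge1 : 1 <= y by rewrite -(powRr0 p%:R) ler_powR // ltW.
have y_geK : 2 * K.+1%:R <= y.
  have := ge0_ler_powR (ltW hs0) _ _ le_p0p.
  rewrite -powRrM mulVf ?gt_eqF // powRr1 ?mulr_ge0 //.
  by apply; rewrite nnegrE ?powR_ge0.
set k := Num.truncn (y / 2).
have /andP[k_le k_gt] : k%:R <= y / 2 < k.+1%:R.
  by apply: truncn_itv; lra.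
have le_Kk : (K <= k)%N.
  by rewrite -ltnS -(ltr_nat R); apply: le_lt_trans k_gt; lra.
have le_kpm : (2 * k <= p ^ m)%N.
  rewrite -(ler_nat R) natrM natrX.
  apply: (@le_trans _ _ y); first by lra.
  by rewrite -powR_mulrn ?ler_powR // ler0n.
(* The chain is [p ^ (n * n) <= y ^ D < (2 * (k + 1)) ^ D <= 2 ^ k], strict because
   [y / 2 < k + 1]. *)
have lt_pn : (p ^ (n * n) < 2 ^ k)%N.
  apply: leq_trans _ (K_dom _ le_Kk); rewrite -(ltr_nat R) !natrX natrM.
  apply: (@le_lt_trans _ _ (y ^+ D)).
    rewrite -!powR_mulrn ?ler0n ?powR_ge0 // -powRrM ler_powR //.
    rewrite mulrC -ler_pdivrMr //; apply: ltW; exact: truncnS_gt.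
  by rewrite ltrXn2r //; lra.
have [f fP] := exists_large_projections p_pr le_mn le_kpm lt_pn.
pose E := [set f i | i : 'I_(4 * k)].
have image_gt (W : {vspace 'rV['F_p]_n}) : \dim W = (n - m)%N ->
    (k < #|vcoset W @: E|)%N.
  by move=> dimW; rewrite -imset_comp; apply: fP.
have E_le : #|E|%:R <= 4 * k%:R :> R.
  by rewrite -natrM ler_nat -[leqRHS]card_ord leq_imset_card.
exists E; split.
(* A single subspace of the right dimension bounds [E] from below: [E] has at least as many points
   as it meets cosets, hence at least [k + 1 > y / 2]. *)
- have [U dimU] : exists U : {vspace 'rV['F_p]_n}, \dim U = (n - m)%N.
    pose X := vbasis {: 'rV['F_p]_n}.
    exists <<take (n - m) X>>%VS.
    have : free X by apply: basis_free (vbasisP _).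
    rewrite -{1}(cat_take_drop (n - m) X) => /catl_free /eqP ->.
    by rewrite size_takel // size_tuple dimvf /dim /= mul1n leq_subr.
  have := leq_trans (image_gt U dimU) (leq_imset_card (vcoset U) E).
  by rewrite -(ler_nat R) -natr1; lra.
- by lra.
- move=> W dimW.
  have : (k < #|cosets_meeting W E|)%N.
    apply: leq_trans (image_gt W dimW) _.
    apply/subset_leq_card/subsetP => _ /imsetP[x xE ->].
    apply/imsetP; exists x => //; rewrite inE.
    apply/set0Pn; exists x; rewrite inE xE /=.
    by apply/imsetP; exists 0; rewrite ?mem0v ?addr0.
  (* More than [k] cosets are met, and [k] is at least a quarter of the size of [E] by [E_le]. *)
  by rewrite -(ler_nat R) -natr1; lra.
Qed.
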